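(* On $T^*\mathbb{R}^2\equiv\mathbb{R}^4$ with canonical coordinates $(q_1,q_2,p_1,p_2)$ and canonical symplectic form $\omega=\mathrm{d}q_1\wedge\mathrm{d}p_1+\mathrm{d}q_2\wedge\mathrm{d}p_2$, consider the $\mathfrak{so}(1,3)$-Lie--Hamilton system $\mathbf{X}=\sum_{\alpha=1}^6 b_\alpha(t)\mathbf{X}_\alpha$, $b_\alpha\in C^\infty(\mathbb{R})$, whose Vessiot--Guldberg Lie algebra, isomorphic to $\mathfrak{so}(1,3)$, is spanned by $$\begin{aligned} \mathbf{X}_1&=\tfrac12\left(p_2\partial_{q_1}+p_1\partial_{q_2}-q_2\partial_{p_1}-q_1\partial_{p_2}\right),\\ \mathbf{X}_2&=\tfrac12\left(p_1\partial_{q_1}-p_2\partial_{q_2}-q_1\partial_{p_1}+q_2\partial_{p_2}\right),\\ \mathbf{X}_3&=\tfrac12\left(-q_2\partial_{q_1}+q_1\partial_{q_2}-p_2\partial_{p_1}+p_1\partial_{p_2}\right),\\ \mathbf{X}_4&=\tfrac12\left(-p_1\partial_{q_1}+p_2\partial_{q_2}-q_1\partial_{p_1}+q_2\partial_{p_2}\right),\\ \mathbf{X}_5&=\tfrac12\left(q_1\partial_{q_1}+q_2\partial_{q_2}-p_1\partial_{p_1}-p_2\partial_{p_2}\right),\\ \mathbf{X}_6&=\tfrac12\left(p_2\partial_{q_1}+p_1\partial_{q_2}+q_2\partial_{p_1}+q_1\partial_{p_2}\right). \end{aligned}$$ This system is intrinsic, i.e., it is not locally diffeomorphic to either the $\mathrm{P}_7$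 class on $T^*\mathbb{R}$ or to the uncoupled sum $\mathrm{P}_7+_{\mathrm{u}}\mathrm{P}_7$ on $T^*\mathbb{R}^2$.
   Context: A Lie system on $\mathbb{R}^n$ is a time-dependent vector field $\sum_{\alpha=1}^r b_\alpha(t)\mathbf{X}_\alpha$ where the vector fields $\mathbf{X}_1,\dots,\mathbf{X}_r$ span an $r$-dimensional real Lie algebra $V^X$, its Vessiot--Guldberg (VG) Lie algebra. It is a Lie--Hamilton system if these vector fields are Hamiltonian with respect to a symplectic form. The $\mathrm{P}_7$ class on $T^*\mathbb{R}\equiv\mathbb{R}^2$, with coordinates $(q,p)$, consists of the Lie systems whose VG Lie algebra (isomorphic to $\mathfrak{so}(1,3)$) is spanned by $\mathbf{Y}_1=\partial_q$, $\mathbf{Y}_2=\partial_p$, $\mathbf{Y}_3=q\partial_q+p\partial_p$, $\mathbf{Y}_4=p\partial_q-q\partial_p$, $\mathbf{Y}_5=(q^2-p^2)\partial_q+2qp\,\partial_p$, $\mathbf{Y}_6=2qp\,\partial_q+(p^2-q^2)\partial_p$. The uncoupled sum $\mathrm{P}_7+_{\mathrm{u}}\mathrm{P}_7$ on $T^*\mathbb{R}^2$ has VG Lie algebra spanned by $\mathbf{Z}_\alpha=\mathbf{Y}_\alpha(q_1,p_1)+\mathbf{Y}_\alpha(q_2,p_2)$, $1\le\alpha\le6$, where $\mathbf{Y}_\alpha(q_i,p_i)$ is $\mathbf{Y}_\alpha$ written in the variables $(q_i,p_i)$; e.g. $\mathbf{Z}_1=\partial_{q_1}+\partial_{q_2}$.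 Two Lie systems on spaces of equal dimension are locally diffeomorphic if there is a diffeomorphism between nonempty open subsets of their domains whose push-forward carries the VG Lie algebra of one onto that of the other. For $m<n$, a Lie system $\mathbf{Y}$ on $\mathbb{R}^m$ is locally diffeomorphic to a Lie system $\mathbf{X}$ on $\mathbb{R}^n$ if $\mathbf{X}$ can be reduced by invariants to a Lie system on (an open subset of) $\mathbb{R}^m$ that is locally diffeomorphic to $\mathbf{Y}$. Reduction by invariants: let $\mathcal{D}^X_\xi=\{\mathbf{Z}|_\xi:\mathbf{Z}\in V^X\}$ have maximal rank $k<n$, attained on the open set $U$. Take (locally on $U$) $n-k$ functionally independent functions $\varphi_i$ with $\mathbf{X}_\alpha(\varphi_i)=0$ for all $\alpha,i$, a nonempty regular level set $\psi^{-1}(\lambda)$ of $\psi=(\varphi_1,\dots,\varphi_{n-k})$, and a diffeomorphism $\phi:W'\to W$ from an open set $W'\subset\mathbb{R}^k$ onto an open set $W\subset\psi^{-1}(\lambda)$; the reduced Lie system on $W'\subset\mathbb{R}^k$ is $\sum_\alpha b_\alpha(t)(\phi^{-1})_*(\mathbf{X}_\alpha)$, with VG Lie algebra $(\phi^{-1})_*(V^X)$. *)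

(* Defs.v *)
From HB Require Import structures.
From mathcomp Require Import all_boot all_order all_algebra.
From mathcomp Require Import all_classical all_reals all_analysis.

Set Implicit Arguments.
Unset Strict Implicit.
Unset Printing Implicit Defensive.

Import Order.TTheory GRing.Theory Num.Theory.
Import numFieldNormedType.Exports.

Local Open Scope classical_set_scope.
Local Open Scope ring_scope.

Section Smoothness.
Context {R : realType} {V W : normedModType R}.

(* For [O] open, [Ck k O f] says that [f] is of class C^k on [O]: in finite
   dimension, continuity of all the [k]-fold directional derivatives is
   continuity of all the partial derivatives of order [k]. *)
Fixpoint Ck (k : nat) (O : set V) (f : V -> W) : Prop :=
  match k with
  | 0 => forall x, O x -> {for x, continuous f}
  | k'.+1 => (forall x, O x -> differentiable f x) /\
             (forall v : V, Ck k' O (fun x => 'D_v f x))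
  end.

(* Smoothness on an arbitrary subset: local extendability to a smooth function
   of the ambient space. On an open set this is ordinary C^oo smoothness; on an
   open subset of a regular level set it is smoothness on the submanifold. *)
Definition smooth_on (A : set V) (f : V -> W) : Prop :=
  forall x, A x -> exists (O : set V) (g : V -> W),
    [/\ open O, O x, forall k, Ck k O g & forall y, A y -> O y -> g y = f y].

End Smoothness.

Definition diffeo (R : realType) (V W : normedModType R)
    (A : set V) (B : set W) (f : V -> W) (g : W -> V) : Prop :=
  [/\ smooth_on A f, smooth_on B g,
      (forall x, A x -> B (f x) /\ g (f x) = x)
    & (forall y, B y -> A (g y) /\ f (g y) = y)].

Section VectorFields.
Context {R : realType}.

Definition vfield (n : nat) := 'rV[R]_n -> 'rV[R]_n.

Definition lie_bracket n (X Y : vfield n) : vfield n :=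
  fun x => 'D_(X x) Y x - 'D_(Y x) X x.

(* Vector fields on [D] are represented by total functions whose values outside
   [D] are irrelevant, so membership in the span is tested on [D] only. *)
Definition vf_span n r (D : set 'rV[R]_n) (X : 'I_r -> vfield n)
    : set (vfield n) :=
  [set Y | exists c : 'I_r -> R,
     forall x, D x -> Y x = \sum_(a < r) c a *: X a x].

(* [pushes f A X Y]: the push-forward of [X] restricted to [A] by [f] is [Y]
   restricted to [f @` A]. *)
Definition pushes m n (f : 'rV[R]_m -> 'rV[R]_n) (A : set 'rV[R]_m)
    (X : vfield m) (Y : vfield n) : Prop :=
  forall x, A x -> Y (f x) = 'd f x (X x).

Definition carries_onto m n (f : 'rV[R]_m -> 'rV[R]_n) (A : set 'rV[R]_m)
    (L : set (vfield m)) (L' : set (vfield n)) : Prop :=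
  (forall X, L X -> exists2 Y, L' Y & pushes f A X Y) /\
  (forall Y, L' Y -> exists2 X, L X & pushes f A X Y).

End VectorFields.

Section LieSystems.
Context {R : realType}.

(* The data of the t-dependent vector field \sum_a ls_coef a t *: ls_field a
   on [ls_dom]; the axioms are in [is_lie_system]. *)
Record lieSystem (n : nat) := LieSystem {
  ls_dom : set 'rV[R]_n;
  ls_size : nat;
  ls_field : 'I_ls_size -> @vfield R n;
  ls_coef : 'I_ls_size -> R -> R }.

Arguments ls_field {n} S a x : rename.
Arguments ls_coef {n} S a t : rename.

Definition VG n (S : lieSystem n) : set (@vfield R n) :=
  vf_span (ls_dom S) (ls_field S).

Definition is_lie_system n (S : lieSystem n) : Prop :=
  [/\ open (ls_dom S),
      forall a, smooth_on (ls_dom S) (ls_field S a),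
      (forall c : 'I_(ls_size S) -> R,
         (forall x, ls_dom S x -> \sum_a c a *: ls_field S a x = 0) ->
         forall a, c a = 0)
    & forall X Y, VG S X -> VG S Y ->
        VG S (lie_bracket X Y)].

Definition locally_diffeo_eqdim n (S T : lieSystem n) : Prop :=
  exists (A B : set 'rV[R]_n) (f g : 'rV[R]_n -> 'rV[R]_n),
  [/\ [/\ open A, A !=set0 & A `<=` ls_dom S],
      open B /\ B `<=` ls_dom T,
      diffeo A B f g
    & carries_onto f A (VG S) (VG T)].

Definition VG_rank n (S : lieSystem n) (x : 'rV[R]_n) : nat :=
  \dim <<[seq ls_field S a x | a : 'I_(ls_size S)]>>%VS.

Definition diff_rank n m (phi : 'I_m -> 'rV[R]_n -> R) (x : 'rV[R]_n) : nat :=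
  \rank (\matrix_(i < m, j < n) 'd (phi i) x (delta_mx 0 j)).

(* [reduces_by_invariants S W' Y]: the Lie system [S] on an open subset of R^n
   reduces to the one on the open set [W'] of R^k with the fields [Y] and the
   coefficients of [S]. The field [Y a] is the image of [ls_field a] under the
   inverse of the diffeomorphism [chi : W' -> W]: it is the field on [W'] pushed
   by [chi] onto the restriction of [ls_field a] to [W]. *)
Definition reduces_by_invariants n k (S : lieSystem n) (W' : set 'rV[R]_k)
    (Y : 'I_(ls_size S) -> @vfield R k) : Prop :=
  [/\ (k < n)%N,
      forall x, ls_dom S x -> (VG_rank S x <= k)%N
    & exists (U : set 'rV[R]_n) (phi : 'I_(n - k) -> 'rV[R]_n -> R)
             (lambda : 'I_(n - k) -> R) (O : set 'rV[R]_n)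
             (chi : 'rV[R]_k -> 'rV[R]_n) (chi' : 'rV[R]_n -> 'rV[R]_k),
      let level := [set x | U x /\ forall i, phi i x = lambda i] in
      [/\ open U /\ (forall x, U x -> ls_dom S x /\ VG_rank S x = k),
          [/\ forall i, smooth_on U (phi i),
              (forall a i x, U x -> 'd (phi i) x (ls_field S a x) = 0)
            & U `<=` closure [set x | U x /\ diff_rank phi x = (n - k)%N]],
          level !=set0 /\ (forall x, level x -> diff_rank phi x = (n - k)%N),
          [/\ open W', open O & diffeo W' (O `&` level) chi chi']
        & forall a, pushes chi W' (Y a) (ls_field S a)]].

Definition locally_diffeo_lowdim m n (T : lieSystem m) (S : lieSystem n)
    : Prop :=
  exists (W' : set 'rV[R]_m) (Y : 'I_(ls_size S) -> @vfield R m),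
    reduces_by_invariants W' Y /\
    locally_diffeo_eqdim (LieSystem W' Y (ls_coef S)) T.

Definition so13 : set 'M[R]_4 :=
  let eta : 'M[R]_4 := \matrix_(i, j) (if i != j then 0
                                       else if i == 0 then 1 else -1) in
  [set A | A^T *m eta + eta *m A = 0].

(* A Lie algebra isomorphism from so(1,3) onto the VG Lie algebra of [S]. *)
Definition VG_iso_so13 n (S : lieSystem n) : Prop :=
  exists F : 'M[R]_4 -> @vfield R n,
  [/\ forall A, so13 A -> VG S (F A),
      (forall X, VG S X ->
         exists2 A, so13 A & forall x, ls_dom S x -> F A x = X x),
      (forall A, so13 A -> (forall x, ls_dom S x -> F A x = 0) -> A = 0),
      (forall c A B, so13 A -> so13 B ->
         forall x, ls_dom S x -> F (c *: A + B) x = c *: F A x + F B x)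
    & forall A B, so13 A -> so13 B -> forall x, ls_dom S x ->
        F (A *m B - B *m A) x = lie_bracket (F A) (F B) x].

End LieSystems.

Arguments ls_field {R n} S a x : rename.
Arguments ls_coef {R n} S a t : rename.

Section TheSystems.
Context {R : realType}.

Definition vec2 (a b : R) : 'rV[R]_2 := \row_j [:: a; b]`_j.
Definition vec4 (a b c d : R) : 'rV[R]_4 := \row_j [:: a; b; c; d]`_j.

(* Coordinates on R^4 are ordered (q1, q2, p1, p2). *)
Definition q1 (x : 'rV[R]_4) : R := x 0 (inord 0).
Definition q2 (x : 'rV[R]_4) : R := x 0 (inord 1).
Definition p1 (x : 'rV[R]_4) : R := x 0 (inord 2).
Definition p2 (x : 'rV[R]_4) : R := x 0 (inord 3).

(* dq1 /\ dp1 + dq2 /\ dp2 *)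
Definition omega (u v : 'rV[R]_4) : R :=
  (q1 u * p1 v - p1 u * q1 v) + (q2 u * p2 v - p2 u * q2 v).

Definition hamiltonian_on (D : set 'rV[R]_4) (X : @vfield R 4) : Prop :=
  exists h : 'rV[R]_4 -> R, smooth_on D h /\
    forall x, D x -> forall v, omega (X x) v = 'd h x v.

Definition is_lie_hamilton_system (S : @lieSystem R 4) : Prop :=
  is_lie_system S /\ forall a, hamiltonian_on (ls_dom S) (ls_field S a).

Definition X_fields : 6.-tuple (@vfield R 4) := [tuple
  (fun x => 2^-1 *: vec4 (p2 x) (p1 x) (- q2 x) (- q1 x));
  (fun x => 2^-1 *: vec4 (p1 x) (- p2 x) (- q1 x) (q2 x));
  (fun x => 2^-1 *: vec4 (- q2 x) (q1 x) (- p2 x) (p1 x));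
  (fun x => 2^-1 *: vec4 (- p1 x) (p2 x) (- q1 x) (q2 x));
  (fun x => 2^-1 *: vec4 (q1 x) (q2 x) (- p1 x) (- p2 x));
  (fun x => 2^-1 *: vec4 (p2 x) (p1 x) (q2 x) (q1 x))].

Definition X_system (b : 'I_6 -> R -> R) : lieSystem 4 :=
  LieSystem setT (tnth X_fields) b.

Definition Y_fields : 6.-tuple (@vfield R 2) :=
  let q (x : 'rV[R]_2) := x 0 0 in let p (x : 'rV[R]_2) := x 0 1 in
  [tuple
  (fun _ => vec2 1 0);
  (fun _ => vec2 0 1);
  (fun x => vec2 (q x) (p x));
  (fun x => vec2 (p x) (- q x));
  (fun x => vec2 (q x ^+ 2 - p x ^+ 2) (2 * q x * p x));
  (fun x => vec2 (2 * q x * p x) (p x ^+ 2 - q x ^+ 2))].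

(* Y(q1, p1) + Y(q2, p2) *)
Definition uncoupled (Y : @vfield R 2) : @vfield R 4 := fun x =>
  let y1 := Y (vec2 (q1 x) (p1 x)) in let y2 := Y (vec2 (q2 x) (p2 x)) in
  vec4 (y1 0 0) (y2 0 0) (y1 0 1) (y2 0 1).

Definition P7_class (S : @lieSystem R 2) : Prop :=
  [/\ is_lie_system S, ls_dom S = setT & VG S = vf_span setT (tnth Y_fields)].

Definition P7_uncoupled_P7 (S : @lieSystem R 4) : Prop :=
  [/\ is_lie_system S, ls_dom S = setT
    & VG S = vf_span setT (fun a => uncoupled (tnth Y_fields a))].

Definition intrinsic (S : @lieSystem R 4) : Prop :=
  (forall T, P7_class T -> ~ locally_diffeo_lowdim T S) /\
  (forall T, P7_uncoupled_P7 T -> ~ locally_diffeo_eqdim T S).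

End TheSystems.

(* Main.v *)
(* The linear fields [X_a] come from the action of sl(2, C) on C^2: they span a
   space of rank 4 away from the origin, so no reduction by invariants to the
   plane exists. For the uncoupled sum, the isotropy subalgebras distinguish
   the two systems: the linear part of a field at a point where it vanishes is
   transported by a local diffeomorphism up to conjugation. A matrix in the
   image of sl(2, C) killing a nonzero vector has square zero, since its square
   is always a complex scalar. But (z - z1)(z - z2) d/dz, acting diagonally on
   two copies of the plane, vanishes at (z1, z2) with linear part
   (z1 - z2) (+) (z2 - z1), whose square is nonzero. *)
From HB Require Import structures.
Require Import Defs.
From mathcomp Require Import all_boot all_order all_algebra.
From mathcomp Require Import all_classical all_reals all_analysis.
From mathcomp Require Import ring lra.
Import numFieldNormedType.Exports.
Import Order.TTheory GRing.Theory Num.Theory.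

Set Implicit Arguments.
Unset Strict Implicit.
Unset Printing Implicit Defensive.

Local Open Scope classical_set_scope.
Local Open Scope ring_scope.

(** * Case analysis and sums over four and six indices *)

Lemma forall_ord4 (P : 'I_4 -> Prop) :
  P (inord 0) -> P (inord 1) -> P (inord 2) -> P (inord 3) -> forall i, P i.
Proof.
move=> P0 P1 P2 P3 i; rewrite -(inord_val i).
by case: i => -[|[|[|[|//]]]] ?.
Qed.

Lemma forall_ord6 (P : 'I_6 -> Prop) :
  P (inord 0) -> P (inord 1) -> P (inord 2) -> P (inord 3) -> P (inord 4) ->
  P (inord 5) -> forall i, P i.
Proof.
move=> P0 P1 P2 P3 P4 P5 i; rewrite -(inord_val i).
by case: i => -[|[|[|[|[|[|//]]]]]] ?.
Qed.

Lemma sum_ord4 (V : nmodType) (F : 'I_4 -> V) :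
  \sum_i F i = F (inord 0) + F (inord 1) + F (inord 2) + F (inord 3).
Proof.
rewrite !big_ord_recl big_ord0 addr0 !addrA.
by do ?congr (_ + _); congr F; apply: val_inj; rewrite /= inordK.
Qed.

Lemma sum_ord6 (V : nmodType) (F : 'I_6 -> V) :
  \sum_i F i = F (inord 0) + F (inord 1) + F (inord 2) + F (inord 3) +
               F (inord 4) + F (inord 5).
Proof.
rewrite !big_ord_recl big_ord0 addr0 !addrA.
by do ?congr (_ + _); congr F; apply: val_inj; rewrite /= inordK.
Qed.

(** * Smoothness of linear maps and quadratic forms *)

Section Smooth.
Context {R : realType}.

Lemma mulmxr_differentiable m n (M : 'M[R]_(m, n)) (x : 'rV[R]_m) :
  differentiable (fun y : 'rV[R]_m => y *m M) x.
Proof.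
rewrite (_ : (fun _ => _) = \sum_i (fun y : 'rV[R]_m => y 0 i *: row i M)).
  apply: differentiable_sum => i.
  by apply: differentiableZl; exact: differentiable_coord.
by apply/funext => y; rewrite mulmx_sum_row fct_sumE.
Qed.

Lemma mulmxr_continuous m n (M : 'M[R]_(m, n)) :
  continuous (mulmxr M : 'rV[R]_m -> 'rV[R]_n).
Proof. move=> x; exact/differentiable_continuous/mulmxr_differentiable. Qed.

Lemma coord_mulmxr_differentiable m n (M : 'M[R]_(m, n)) j (x : 'rV[R]_m) :
  differentiable (fun y : 'rV[R]_m => (y *m M) 0 j : R) x.
Proof.
apply: (differentiable_comp (f := fun y => y *m M)
                            (g := fun z : 'rV[R]_n => z 0 j : R)).
  exact: mulmxr_differentiable.
exact: differentiable_coord.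
Qed.

Lemma derive_mulmxr m n (M : 'M[R]_(m, n)) (x v : 'rV[R]_m) :
  'D_v (fun y : 'rV[R]_m => y *m M) x = v *m M.
Proof.
rewrite deriveE; last exact: mulmxr_differentiable.
by rewrite (diff_lin (f := mulmxr M)) //; exact: mulmxr_continuous.
Qed.

Lemma Ck_cst (V W : normedModType R) k (O : set V) (w : W) :
  Ck k O (fun=> w).
Proof.
elim: k w => [|k IH] w /=; first by move=> x _; exact: cst_continuous.
split=> [x _|v]; first exact: differentiable_cst.
by rewrite [X in Ck _ _ X](_ : _ = fun=> 0) //;
  apply/funext => x; rewrite derive_cst.
Qed.

Lemma Ck_linear (V W : normedModType R) k (O : set V) (f : {linear V -> W}) :
  continuous f -> Ck k O f.
Proof.
move=> fc; case: k => [x _|k /=]; first exact: fc.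
split=> [x _|v]; first exact: linear_differentiable.
rewrite [X in Ck _ _ X](_ : _ = fun=> f v); first exact: Ck_cst.
apply/funext => x; rewrite deriveE ?diff_lin //; exact: linear_differentiable.
Qed.

Lemma smooth_on_Ck (V W : normedModType R) (A : set V) (f : V -> W) :
  (forall k, Ck k setT f) -> smooth_on A f.
Proof. by move=> fC x Ax; exists setT, f; split => //; exact: openT. Qed.

(** Serves as the Hamiltonian of a linear field; the factor one half makes [x *m S] its gradient
    when [S] is symmetric. *)
Definition qform n (S : 'M[R]_n) (x : 'rV[R]_n) : R :=
  2^-1 * \sum_j (x *m S) 0 j * x 0 j.

Lemma is_diff_qform n (S : 'M[R]_n) (x : 'rV[R]_n) :
  S^T = S -> differentiable (qform S) x /\
  forall v, 'd (qform S) x v = \sum_j (x *m S) 0 j * v 0 j.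
Proof.
move=> Ssym.
pose l j : 'rV[R]_n -> R := fun y => (y *m S) 0 j.
pose c j : 'rV[R]_n -> R := fun y => y 0 j.
have dc j y : differentiable (c j) y by exact: differentiable_coord.
have dl j y : differentiable (l j) y by exact: coord_mulmxr_differentiable.
have Dc j y v : 'D_v (c j) y = v 0 j.
  have : derivable (id : 'rV[R]_n -> _) y v by []. move=> /derive_mx.
  by rewrite derive_id => {2}->; rewrite mxE.
have Dl j y v : 'D_v (l j) y = (v *m S) 0 j.
  have : derivable (mulmxr S : 'rV[R]_n -> _) y v.
    exact/diff_derivable/mulmxr_differentiable.
  by move=> /derive_mx; rewrite derive_mulmxr => ->; rewrite mxE.
have qE : qform S = 2^-1 \*: (\sum_j (l j * c j)).
  by apply/funext => y; rewrite /qform /= fct_sumE.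
have dq y : differentiable (qform S) y.
  rewrite qE; apply: differentiableZ; apply: differentiable_sum => j.
  exact: differentiableM.
split=> // v; rewrite -deriveE // qE deriveZ; last first.
  by apply: derivable_sum => j; apply: derivableM; exact: diff_derivable.
rewrite derive_sum; last first.
  by move=> j; apply: derivableM; exact: diff_derivable.
(* By symmetry of [S] the two terms of the product rule agree, and their sum absorbs the factor one
   half. *)
have sym : \sum_j (v *m S) 0 j * x 0 j = \sum_j (x *m S) 0 j * v 0 j.
  have E (a d : 'rV[R]_n) : \sum_j a 0 j * d 0 j = (a *m d^T) 0 0.
    by rewrite mxE; apply: eq_bigr => j _; rewrite mxE.
  rewrite !E; transitivity ((v *m S *m x^T)^T 0 0); first by rewrite [RHS]mxE.
  by rewrite !trmx_mul trmxK Ssym mulmxA.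
rewrite (eq_bigr (fun j => (x *m S) 0 j * v 0 j + (v *m S) 0 j * x 0 j)).
  rewrite big_split /= sym; set T := \sum_j _.
  rewrite -[LHS]/(2^-1 * (T + T)); lra.
move=> j _; rewrite deriveM; try exact: diff_derivable.
by rewrite Dc Dl -[LHS]/(_ * _ + _ * _) /l /c [x 0 j * _]mulrC.
Qed.

(** Every directional derivative of a quadratic form is linear in the point, so the linear case
    settles the higher orders. *)
Lemma Ck_qform n (S : 'M[R]_n) k : S^T = S -> Ck k setT (qform S).
Proof.
move=> Ssym; have dq x := is_diff_qform x Ssym.
case: k => [x _|k /=].
  by apply: differentiable_continuous; case: (dq x).
split=> [x _|v]; first by case: (dq x).
have lin : linear (fun x : 'rV[R]_n => (x *m (S *m v^T)) 0 0 : R).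
  by move=> a x y; rewrite mulmxDl -scalemxAl !mxE.
pose f : {linear 'rV[R]_n -> R} :=
  HB.pack (fun x : 'rV[R]_n => (x *m (S *m v^T)) 0 0 : R)
          (GRing.isLinear.Build _ _ _ _ _ lin).
have -> : (fun x => 'D_v (qform S) x) = f.
  apply/funext => x; case: (dq x) => dqx E; rewrite deriveE // E /=.
  by rewrite mulmxA mxE; apply: eq_bigr => j _; congr (_ * _); rewrite mxE.
apply: Ck_linear => x; apply: differentiable_continuous.
exact: (coord_mulmxr_differentiable (S *m v^T)).
Qed.

End Smooth.

Ltac mx4 := rewrite ?mxE ?sum_ord4 ?mxE ?inordK //=.

(** * The fields [X_a] as linear fields and their Lie algebra *)

Section LinearFields.
Context {R : realType}.
Implicit Types (c d : 'I_6 -> R) (x v : 'rV[R]_4).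

Definition mat4 (s : seq (seq R)) : 'M[R]_4 :=
  \matrix_(i, j) (nth [::] s i)`_j.

(** Acts on row vectors from the right. In the coordinates [q1 + i q2] and [p1 - i p2] it is a
    traceless complex 2 x 2 matrix, that is, an element of sl(2, C). *)
Definition X_mx c : 'M[R]_4 :=
  let: c1 := c (inord 0) in let: c2 := c (inord 1) in
  let: c3 := c (inord 2) in let: c4 := c (inord 3) in
  let: c5 := c (inord 4) in let: c6 := c (inord 5) in
  2^-1 *: mat4
   ([:: [:: c5;      c3;      - c2 - c4; c6 - c1];
        [:: - c3;    c5;      c6 - c1;   c2 + c4];
        [:: c2 - c4; c1 + c6; - c5;      c3];
        [:: c1 + c6; c4 - c2; - c3;      - c5]]).

Lemma X_fieldsE c x : \sum_a c a *: tnth X_fields a x = x *m X_mx c.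
Proof.
apply/rowP; rewrite sum_ord6 !(tnth_nth (fun=> 0)) !inordK //=.
by elim/forall_ord4; rewrite /q1 /q2 /p1 /p2; mx4; field.
Qed.

(* The structure constants of the basis [X_1, ..., X_6]. *)
Definition bracket_coef c d : 'I_6 -> R :=
  let: w := fun i j : nat => c (inord i) * d (inord j) -
                             c (inord j) * d (inord i) in
  fun a => [:: w 1%N 2%N - w 4%N 5%N; - w 0%N 2%N - w 3%N 4%N;
               w 0%N 1%N - w 3%N 5%N; - w 1%N 4%N - w 2%N 5%N;
               w 1%N 3%N - w 0%N 5%N; w 0%N 4%N + w 2%N 3%N]`_a.

Lemma X_mx_bracket c d :
  X_mx (bracket_coef c d) = X_mx c *m X_mx d - X_mx d *m X_mx c.
Proof.
rewrite /X_mx /bracket_coef !inordK //=.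
move: (c (inord 0)) (c (inord 1)) (c (inord 2)) (c (inord 3)) (c (inord 4))
  (c (inord 5)) => c1 c2 c3 c4 c5 c6.
move: (d (inord 0)) (d (inord 1)) (d (inord 2)) (d (inord 3)) (d (inord 4))
  (d (inord 5)) => d1 d2 d3 d4 d5 d6.
by apply/matrixP; elim/forall_ord4; elim/forall_ord4; mx4; field.
Qed.

Lemma X_mx_inj c : X_mx c = 0 -> forall a, c a = 0.
Proof.
move/matrixP => M0.
(* The first and third rows suffice: sums and differences of these six entries recover all the
   coefficients. *)
have := M0 (inord 0) (inord 0); have := M0 (inord 0) (inord 1).
have := M0 (inord 0) (inord 2); have := M0 (inord 0) (inord 3).
have := M0 (inord 2) (inord 0); have := M0 (inord 2) (inord 1).
mx4 => e1 e2 e3 e4 e5 e6.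
by elim/forall_ord6; lra.
Qed.

Lemma X_mx_linear (k : R) c d :
  X_mx (fun a => k * c a + d a) = k *: X_mx c + X_mx d.
Proof. by apply/matrixP; elim/forall_ord4; elim/forall_ord4; mx4; field. Qed.

(** By Cayley-Hamilton a traceless complex 2 x 2 matrix squares to a scalar, and a scalar that kills
    a nonzero vector is zero. *)
Lemma X_mx_sqr_nilpotent c x :
  x != 0 -> x *m X_mx c = 0 -> X_mx c *m X_mx c = 0.
Proof.
move=> x0 xM.
pose c1 := c (inord 0); pose c2 := c (inord 1); pose c3 := c (inord 2).
pose c4 := c (inord 3); pose c5 := c (inord 4); pose c6 := c (inord 5).
(* In the complex coordinates [q1 + i q2] and [p1 - i p2], the matrix
   [X_mx c *m X_mx c] is multiplication by [s + i t]. *)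
pose s := 4^-1 * (c4 ^+ 2 + c5 ^+ 2 + c6 ^+ 2 - c1 ^+ 2 - c2 ^+ 2 - c3 ^+ 2).
pose t := 2^-1 * (c3 * c5 - c2 * c6 - c1 * c4).
have MM : X_mx c *m X_mx c = mat4
   ([:: [:: s; t; 0; 0]; [:: - t; s; 0; 0]; [:: 0; 0; s; - t];
        [:: 0; 0; t; s]]).
  apply/matrixP; elim/forall_ord4; elim/forall_ord4;
    rewrite /s /t /c1 /c2 /c3 /c4 /c5 /c6; mx4; by field.
have /rowP xMM : x *m (X_mx c *m X_mx c) = 0 by rewrite mulmxA xM mul0mx.
have st : s = 0 /\ t = 0.
  move: (xMM (inord 0)) (xMM (inord 1)) (xMM (inord 2)) (xMM (inord 3)).
  rewrite MM; mx4; rewrite !(mulr0, addr0, add0r) => e0 e1 e2 e3.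
  have /existsP[i xi] : [exists i, x 0 i != 0].
    apply/contraT; rewrite negb_exists => /forallP x00.
    case/negP: x0; apply/eqP/rowP => i; rewrite mxE; apply/eqP.
    by have := x00 i; rewrite negbK.
  (* Multiplying by the conjugate [s - i t] shows that the squared modulus kills every coordinate,
     in particular the nonzero one. *)
  have : s ^+ 2 + t ^+ 2 = 0.
    apply: (mulIf (x := x 0 i ^+ 2)); first by rewrite sqrf_eq0.
    rewrite mul0r; move: i xi; elim/forall_ord4 => _; nra.
  by move=> st; split; nra.
rewrite MM; case: st => -> ->; apply/matrixP.
by elim/forall_ord4; elim/forall_ord4; mx4; rewrite ?oppr0.
Qed.

(** With matrices acting on rows, the bracket of linear fields is the matrix commutator with no
    change of sign. *)
Lemma lie_bracket_mulmxr c d :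
  lie_bracket (fun x => x *m X_mx c) (fun x => x *m X_mx d)
  = fun x => x *m X_mx (bracket_coef c d).
Proof.
apply/funext => x; rewrite /lie_bracket !derive_mulmxr X_mx_bracket mulmxBr.
by rewrite !mulmxA.
Qed.

Lemma VG_X_systemP (b : 'I_6 -> R -> R) (X : @vfield R 4) :
  VG (X_system b) X <-> exists c, X = fun x => x *m X_mx c.
Proof.
split=> -[c cX]; exists c.
  by apply/funext => x; rewrite -X_fieldsE; exact: cX.
by move=> x _ /=; rewrite cX X_fieldsE.
Qed.

Lemma X_field_mulmxr a :
  tnth X_fields a = fun x => x *m X_mx (fun a' => (a' == a)%:R).
Proof.
apply/funext => x; rewrite -X_fieldsE (bigD1 a) //= eqxx scale1r big1 ?addr0 //.
by move=> i /negPf ->; rewrite scale0r.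
Qed.

(** * The Hamiltonian structure *)

Definition Omega : 'M[R]_4 :=
  mat4 [:: [:: 0; 0; 1; 0]; [:: 0; 0; 0; 1];
           [:: -1; 0; 0; 0]; [:: 0; -1; 0; 0]].

Lemma omegaE x v : omega x v = \sum_j (x *m Omega) 0 j * v 0 j.
Proof. by rewrite /omega /q1 /q2 /p1 /p2 sum_ord4; mx4; ring. Qed.

(** This symmetry says that the matrix lies in the symplectic Lie algebra, so its linear field has a
    quadratic Hamiltonian. *)
Lemma X_mx_Omega_sym c : (X_mx c *m Omega)^T = X_mx c *m Omega.
Proof. by apply/matrixP; elim/forall_ord4; elim/forall_ord4; mx4; ring. Qed.

Lemma X_system_lie_hamilton (b : 'I_6 -> R -> R) :
  is_lie_hamilton_system (X_system b).
Proof.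
split; first split=> /=.
- exact: openT.
- move=> a; apply: smooth_on_Ck => k; rewrite X_field_mulmxr.
  by apply: (@Ck_linear _ _ _ k _ (mulmxr _)); exact: mulmxr_continuous.
- move=> c c0; apply: X_mx_inj; apply/row_matrixP => i.
  by rewrite row0 rowE -X_fieldsE; exact: c0.
- move=> X Y /VG_X_systemP[c ->] /VG_X_systemP[d ->].
  by apply/VG_X_systemP; exists (bracket_coef c d); rewrite lie_bracket_mulmxr.
move=> a /=; rewrite X_field_mulmxr; move: (fun a' => (a' == a)%:R) => c.
have S := X_mx_Omega_sym c; exists (qform (X_mx c *m Omega)); split.
  by apply: smooth_on_Ck => k; exact: Ck_qform.
by move=> x _ v; case: (is_diff_qform x S) => _ ->; rewrite omegaE mulmxA.
Qed.

(** * The isomorphism with so(1,3) *)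

Definition so13_coef (A : 'M[R]_4) : 'I_6 -> R :=
  let: e := fun i j : nat => A (inord i) (inord j) in
  fun a => [:: - e 2%N 3%N; - e 1%N 2%N; - e 1%N 3%N;
               e 0%N 1%N; e 0%N 2%N; e 0%N 3%N]`_a.

(** Rotations carry [c1], [c2], [c3] and boosts [c4], [c5], [c6]; order and signs are chosen so that
    the structure constants are those of the [X_a]. *)
Definition so13_mx c : 'M[R]_4 :=
  let: c1 := c (inord 0) in let: c2 := c (inord 1) in
  let: c3 := c (inord 2) in let: c4 := c (inord 3) in
  let: c5 := c (inord 4) in let: c6 := c (inord 5) in
  mat4 [:: [:: 0; c4; c5; c6]; [:: c4; 0; - c2; - c3];
           [:: c5; c2; 0; - c1]; [:: c6; c3; c1; 0]].

Lemma so13_coefK c : so13_coef (so13_mx c) = c.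
Proof.
apply/funext; elim/forall_ord6; rewrite /so13_coef ?inordK //=;
  by rewrite /so13_mx mxE ?inordK //= ?opprK.
Qed.

Lemma so13E (A : 'M[R]_4) : so13 A <->
  forall i j, A j i * (if j == 0 then 1 else -1)
              + (if i == 0 then 1 else -1) * A i j = 0.
Proof.
rewrite /so13 /=; set eta := \matrix_(i, j) _.
have -> : eta = diag_mx (\row_i (if i == 0 then 1 else -1)).
  apply/matrixP => i j; by rewrite !mxE; case: eqVneq => [->|_].
rewrite mul_mx_diag mul_diag_mx; split=> [/matrixP e i j|e].
  by have := e i j; rewrite !mxE.
by apply/matrixP => i j; rewrite !mxE; exact: e.
Qed.

Lemma so13_mx_so13 c : so13 (so13_mx c).
Proof.
apply/so13E; elim/forall_ord4; elim/forall_ord4;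
  rewrite -!val_eqE /= ?inordK //=; mx4; ring.
Qed.

Lemma so13_mxK (A : 'M[R]_4) : so13 A -> so13_mx (so13_coef A) = A.
Proof.
move/so13E => e; apply/matrixP.
elim/forall_ord4; elim/forall_ord4; rewrite /so13_mx /so13_coef mxE !inordK //=;
  match goal with |- context [fun_of_matrix A ?i ?j] => move: (e i j) end;
  by rewrite -!val_eqE /= ?inordK //=; lra.
Qed.

Lemma so13_mx_bracket c d :
  so13_mx c *m so13_mx d - so13_mx d *m so13_mx c = so13_mx (bracket_coef c d).
Proof.
rewrite /so13_mx /bracket_coef !inordK //=.
move: (c (inord 0)) (c (inord 1)) (c (inord 2)) (c (inord 3)) (c (inord 4))
  (c (inord 5)) => c1 c2 c3 c4 c5 c6.
move: (d (inord 0)) (d (inord 1)) (d (inord 2)) (d (inord 3)) (d (inord 4))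
  (d (inord 5)) => d1 d2 d3 d4 d5 d6.
by apply/matrixP; elim/forall_ord4; elim/forall_ord4; mx4; ring.
Qed.

(** Both algebras have the bracket [bracket_coef] in their coefficients, so matching coefficients is
    an isomorphism. *)
Lemma X_system_so13 (b : 'I_6 -> R -> R) : VG_iso_so13 (X_system b).
Proof.
exists (fun A x => x *m X_mx (so13_coef A)); split=> /=.
- by move=> A _; apply/VG_X_systemP; exists (so13_coef A).
- move=> X /VG_X_systemP[c ->]; exists (so13_mx c); first exact: so13_mx_so13.
  by move=> x _; rewrite so13_coefK.
- move=> A sA A0; have /X_mx_inj c0 : X_mx (so13_coef A) = 0.
    by apply/row_matrixP => i; rewrite row0 rowE; exact: A0.
  rewrite -(so13_mxK sA) /so13_mx !c0.
  by apply/matrixP; elim/forall_ord4; elim/forall_ord4; mx4; rewrite ?oppr0.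
- move=> k A B sA sB x _; rewrite scalemxAr -mulmxDr -X_mx_linear.
  congr (_ *m X_mx _); apply/funext; elim/forall_ord6;
    by rewrite /so13_coef ?inordK //= !mxE; ring.
- move=> A B sA sB x _; rewrite lie_bracket_mulmxr.
  by rewrite -[in LHS](so13_mxK sA) -[in LHS](so13_mxK sB) so13_mx_bracket
    so13_coefK.
Qed.

Lemma X_system_rank (b : 'I_6 -> R -> R) :
  VG_rank (X_system b) (vec4 1 0 0 0) = 4%N.
Proof.
rewrite /VG_rank; set s := [seq _ | a : 'I_6].
suff -> : (<< s >>)%VS = fullv by rewrite dimvf.
apply/eqP; rewrite eqEsubv subvf /=; apply/subvP => v _.
have sE (c : 'I_6 -> R) : vec4 1 0 0 0 *m X_mx c \in (<< s >>)%VS.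
  rewrite -X_fieldsE; apply: memv_suml => a _; apply: memvZ.
  by apply: memv_span; apply: (codom_f (fun a : 'I_6 => _)). 
(* Solves for the first row of [X_mx c] to be [v], with the coefficients of [X_1] and [X_4] set to
   zero. *)
pose c : 'I_6 -> R := fun a => [:: 0; - 2 * v 0 (inord 2);
  2 * v 0 (inord 1); 0; 2 * v 0 (inord 0); 2 * v 0 (inord 3)]`_a.
rewrite (_ : v = vec4 1 0 0 0 *m X_mx c) //.
by apply/rowP; elim/forall_ord4; rewrite mxE sum_ord4 /X_mx /c !inordK //=; mx4;
  field.
Qed.

End LinearFields.

(** * Linear parts of fields at their zeros *)

Section Linearization.
Context {R : realType}.

Lemma diffE_coord m n (f : 'rV[R]_m -> 'rV[R]_n) (x w : 'rV[R]_m) :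
  differentiable f x ->
  'd f x w = \sum_j w 0 j *: 'D_(delta_mx 0 j) f x.
Proof.
move=> df; rewrite {1}(row_sum_delta w) linear_sum; apply: eq_bigr => j _.
by rewrite linearZ deriveE.
Qed.

(** Along the line the difference quotient is exactly [w + h *: q], which tends to [w]. *)
Lemma is_derive_quadratic m n (Z : 'rV[R]_m -> 'rV[R]_n) (x v : 'rV[R]_m)
    (w q : 'rV[R]_n) :
  (forall h : R, Z (h *: v + x) = Z x + h *: (w + h *: q)) ->
  is_derive x v Z w.
Proof.
move=> Zh.
have cw : h^-1 *: ((Z \o shift x) (h *: v) - Z x) @[h --> 0^'] --> w.
  have lim0 : w + h *: q @[h --> (0 : R)^'] --> w.
    rewrite -[X in _ --> X]addr0 -(scale0r q).
    apply: cvgD; first exact: cvg_cst.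
    by apply: cvgZr_tmp; apply: cvg_within.
  apply: cvg_trans lim0; apply: near_eq_cvg; near=> h.
  have h0 : h != 0 by near: h; exact: nbhs_dnbhs_neq.
  by rewrite /= Zh [Z x + _]addrC addrK scalerA mulVf // scale1r.
split; first by apply/cvg_ex; exists w.
exact: cvg_lim cw.
Unshelve. all: by end_near. Qed.

(** Differentiate the push-forward relation at [x] along [v]. As [Z x = 0], the quotient on the
    right is the differential of [f] at the moving point applied to the quotient of [Z], so
    continuity of the first derivatives gives the limit. *)
Lemma linearization_conj m n (f : 'rV[R]_m -> 'rV[R]_n) (O : set 'rV[R]_m)
    (Z : 'rV[R]_m -> 'rV[R]_m) (M : 'M[R]_n) (x v w : 'rV[R]_m) :
  open O -> O x -> Ck 1 O f ->
  (forall y, O y -> f y *m M = 'd f y (Z y)) ->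
  Z x = 0 -> is_derive x v Z w ->
  'd f x v *m M = 'd f x w.
Proof.
move=> oO Ox [df cDf] fM Zx0 dZ.
have dfx := df _ Ox.
have dM : differentiable (mulmxr M : 'rV[R]_n -> _) (f x).
  exact: mulmxr_differentiable.
transitivity ('D_v (mulmxr M \o f) x).
  rewrite deriveE; last exact: differentiable_comp.
  apply: etrans (esym (congr1 (@^~ v) (diff_comp dfx dM))).
  have dE := @diff_lin R _ _ (mulmxr M) (f x) (@mulmxr_continuous R n n M).
  exact: (esym (congr1 (@^~ ('d f x v)) dE)).
(* Expanded in partial derivatives, since [Ck 1] provides continuity one direction at a time. *)
pose G y := \sum_j Z y 0 j *: 'D_(delta_mx 0 j) f y.
have -> : 'D_v (mulmxr M \o f) x = 'D_v G x.
  apply: near_eq_derive; near=> y.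
  have Oy : O y by near: y; exact: open_nbhs_nbhs.
  by rewrite /= fM // diffE_coord //; exact: df.
have Gx : G x = 0 by rewrite /G Zx0 big1 // => j _; rewrite mxE scale0r.
rewrite diffE_coord //; apply: cvg_lim => //=.
have cx : h *: v + x @[h --> (0 : R)^'] --> x.
  rewrite -[X in _ --> X]add0r -(scale0r v); apply: cvgD; last exact: cvg_cst.
  by apply: cvgZr_tmp; apply: cvg_within.
rewrite Gx.
have -> : (fun h : R => h^-1 *: (G (h *: v + x) - 0)) =
  \sum_j (fun h : R => (h^-1 *: (Z (h *: v + x) - Z x)) 0 j *:
                       'D_(delta_mx 0 j) f (h *: v + x)).
  apply/funext => h; rewrite fct_sumE subr0 /G scaler_sumr.
  by apply: eq_bigr => j _; rewrite Zx0 subr0 mxE scalerA.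
have cZ : h^-1 *: (Z (h *: v + x) - Z x) @[h --> (0 : R)^'] --> w.
  by case: dZ => dZ <-; exact: dZ.
elim/big_ind2: _ => [|F a G' b Fa Gb|j _]; first exact: cvg_cst.
  exact: cvgD.
apply: cvgZ.
  exact: (cvg_comp _ _ cZ (@coord_continuous _ _ _ 0 j w)).
exact: (cvg_comp _ _ cx (cDf _ _ Ox)).
Unshelve. all: by end_near. Qed.

End Linearization.

(** * Differentials of local diffeomorphisms *)

Section Diffeo.
Context {R : realType}.

Lemma near_eq_diff (V W : normedModType R) (f g : V -> W) (x : V) :
  (\forall y \near x, f y = g y) -> differentiable g x ->
  'd f x = 'd g x :> (V -> W).
Proof.
move=> fg dg; apply: diff_unique; first exact: diff_continuous.
have := diff_locally dg => /eqaddoP gx; apply/eqaddoP => e e0.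
have fgx : f x = g x by exact: nbhs_singleton fg.
have fg0 : \forall y \near (0 : V), f (y + x) = g (y + x).
  have cx : y + x @[y --> (0 : V)] --> x.
    rewrite -[X in _ --> X]add0r.
    by apply: cvgD; [exact: cvg_id|exact: cvg_cst].
  exact: cx fg.
near=> y.
have fgy : f (y + x) = g (y + x) by near: y.
rewrite -[leLHS]/(`|f (y + x) - (f x + 'd g x y)|) fgy fgx.
by near: y; exact: gx.
Unshelve. all: by end_near. Qed.

(** Replaces [f] near [x] by a smooth local extension [f1]. The chain rule for [g1 \o f1], which is
    the identity near [x], makes the differential injective. *)
Lemma diffeo_local m n (A : set 'rV[R]_m) (B : set 'rV[R]_n) f g x :
  open A -> open B -> diffeo A B f g -> A x ->
  exists (O : set 'rV[R]_m) (f1 : 'rV[R]_m -> 'rV[R]_n),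
  [/\ open O /\ O `<=` A, O x, Ck 1 O f1,
      forall y, O y -> f1 y = f y /\ 'd f1 y = 'd f y :> (_ -> _)
    & forall v, 'd f1 x v = 0 -> v = 0].
Proof.
move=> oA oB [sf sg fK gK] Ax.
have [U [f1 [oO Ox f1C f1E]]] := sf x Ax.
have [U2 [g1 [oO2 O2fx g1C g1E]]] := sg _ (proj1 (fK _ Ax)).
have [f1d f1D] := f1C 1; have [g1d _] := g1C 1.
have f1x : f1 x = f x by exact: f1E.
have oAO : open (A `&` U) by exact: openI.
have df1x := f1d _ Ox.
have dg1 : differentiable g1 (f1 x) by rewrite f1x; exact: g1d.
exists (A `&` U), f1; split.
- by split=> // y [].
- by [].
- by split=> [y [_ /f1d]|v y [_ Oy]]; [|exact: (f1D v)].
- move=> y [Ay Oy]; split; first exact: f1E.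
  apply/esym/near_eq_diff; last exact: f1d.
  near=> z; have [Az Oz] : (A `&` U) z by near: z; exact: open_nbhs_nbhs.
  by rewrite f1E.
move=> v dv.
have E := diff_comp df1x dg1.
have : 'D_v (g1 \o f1) x = 'D_v id x.
  apply: near_eq_derive; near=> z.
  have [Az Oz] : (A `&` U) z by near: z; exact: open_nbhs_nbhs.
  (* Continuity of [f1] at [x] keeps nearby images where [g1] extends [g]. *)
  have O2z : U2 (f1 z).
    near: z; apply: (differentiable_continuous df1x).
    by rewrite f1x; exact: open_nbhs_nbhs.
  move: O2z; rewrite /= f1E // => O2z; rewrite g1E //; first by case: (fK z Az).
  by case: (fK z Az).
rewrite derive_id => <-; rewrite deriveE; last exact: differentiable_comp.
rewrite (congr1 (fun F : 'rV[R]_m -> 'rV[R]_m => F v) E) /= dv.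
exact: linear0.
Unshelve. all: by end_near. Qed.

End Diffeo.

(** * Comparison with P7 and with the uncoupled sum *)

Section Intrinsic.
Context {R : realType}.
Implicit Types (c d : 'I_6 -> R) (x v : 'rV[R]_4).

(** A reduction to the plane bounds the rank by 2 on the whole domain, but it is 4 at
    [(1, 0, 0, 0)]. *)
Lemma X_system_not_reducible (b : 'I_6 -> R -> R) (T : @lieSystem R 2) :
  ~ locally_diffeo_lowdim T (X_system b).
Proof.
move=> [W' [Y [[_ rk _] _]]].
by have := rk (vec4 1 0 0 0) I; rewrite X_system_rank.
Qed.

Definition Zfield c : @vfield R 4 :=
  fun x => \sum_a c a *: uncoupled (tnth Y_fields a) x.

Lemma uncoupled_Y1 :
  uncoupled (tnth (@Y_fields R) (inord 0)) = fun=> vec4 1 1 0 0.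
Proof.
apply/funext => x; rewrite /uncoupled (tnth_nth (fun=> 0)) inordK //=.
by rewrite /vec2 !mxE.
Qed.

(** With [z = q + i p], [u + i w] is the complex polynomial [(c1 + i c2) + (c3 - i c4) z + (c5 - i
    c6) z^2]. *)
Lemma ZfieldE c x : Zfield c x =
  let: q1 := q1 x in let: q2 := q2 x in let: p1 := p1 x in let: p2 := p2 x in
  let: c1 := c (inord 0) in let: c2 := c (inord 1) in
  let: c3 := c (inord 2) in let: c4 := c (inord 3) in
  let: c5 := c (inord 4) in let: c6 := c (inord 5) in
  let: u := fun q p => c1 + c3 * q + c4 * p + c5 * (q ^+ 2 - p ^+ 2) +
                       c6 * (2 * q * p) in
  let: w := fun q p => c2 + c3 * p - c4 * q + c5 * (2 * q * p) +
                       c6 * (p ^+ 2 - q ^+ 2) in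
  vec4 (u q1 p1) (u q2 p2) (w q1 p1) (w q2 p2).
Proof.
rewrite /Zfield sum_ord6 !(tnth_nth (fun=> 0)) !inordK //= /uncoupled /vec2.
by apply/rowP; elim/forall_ord4; rewrite !mxE !inordK //=; ring.
Qed.

(* With z_k = q_k + i p_k, these are the coefficients of the field
   (z - z_1)(z - z_2) d/dz; the fields Y_3 and Y_4 are z and -i z. *)
Definition isotropy_coef x : 'I_6 -> R := fun a =>
  [:: q1 x * q2 x - p1 x * p2 x; q1 x * p2 x + p1 x * q2 x;
      - (q1 x + q2 x); p1 x + p2 x; 1; 0]`_a.

Lemma Zfield_isotropy x : Zfield (isotropy_coef x) x = 0.
Proof.
rewrite ZfieldE /isotropy_coef !inordK //=.
by apply/rowP; elim/forall_ord4; mx4; ring.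
Qed.

Lemma is_derive_isotropy x (a b : R) :
  let: d := q1 x - q2 x in let: e := p1 x - p2 x in
  is_derive x (vec4 a 0 b 0) (Zfield (isotropy_coef x))
    (vec4 (d * a - e * b) 0 (d * b + e * a) 0).
Proof.
(* The second-order term is the complex square of the increment [a + i b] of [z_1]. *)
apply: (is_derive_quadratic (q := vec4 (a ^+ 2 - b ^+ 2) 0 (2 * a * b) 0)) => h.
rewrite Zfield_isotropy ZfieldE /isotropy_coef !inordK //=.
apply/rowP; elim/forall_ord4; rewrite /q1 /q2 /p1 /p2; mx4; ring.
Qed.

(** A small shift of [q1] leaves the hyperplane [q1 = q2]; this provides a point with [z_1] and
    [z_2] distinct. *)
Lemma open_q1_neq_q2 (A : set 'rV[R]_4) :
  open A -> A !=set0 -> exists2 x, A x & q1 x != q2 x.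
Proof.
move=> oA [x Ax]; have [q12|q12] := eqVneq (q1 x) (q2 x); last by exists x.
pose y (h : R) := h *: vec4 1 0 0 0 + x.
have cy : y h @[h --> (0 : R)^'] --> x.
  rewrite -[X in _ --> X]add0r -(scale0r (vec4 1 0 0 0)).
  apply: cvgD; last exact: cvg_cst.
  by apply: cvgZr_tmp; apply: cvg_within.
near (0 : R)^' => h; exists (y h).
  by near: h; apply: cy; exact: open_nbhs_nbhs.
have h0 : h != 0 by near: h; exact: nbhs_dnbhs_neq.
move: q12; rewrite /q1 /q2 /y; mx4 => ->.
by apply: contraNneq h0 => e; apply/eqP; lra.
Unshelve. all: by end_near. Qed.

Lemma vec4_eq0 (a b c d : R) :
  vec4 a b c d = 0 -> [/\ a = 0, b = 0, c = 0 & d = 0].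
Proof.
move/rowP => e; move: (e (inord 0)) (e (inord 1)) (e (inord 2)) (e (inord 3)).
by mx4.
Qed.

Lemma X_system_not_uncoupled (b : 'I_6 -> R -> R) (T : @lieSystem R 4) :
  P7_uncoupled_P7 T -> ~ locally_diffeo_eqdim T (X_system b).
Proof.
move=> [_ _ VGT] [A [B [f [g [[oA A0 _] [oB _] dfg [push _]]]]]].
have [x Ax q12] := open_q1_neq_q2 oA A0.
have [U [f1 [[oU UA] Ux f1C f1E f1_inj]]] := diffeo_local oA oB dfg Ax.
have pushZ c : exists m, forall y, U y -> f1 y *m X_mx m = 'd f1 y (Zfield c y).
  have : VG T (Zfield c) by rewrite VGT; exists c.
  move=> /push[Y /VG_X_systemP[m ->] pY]; exists m => y Uy.
  by have [-> ->] := f1E y Uy; rewrite -pY //; exact: UA.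
(* Linear fields vanish at the origin, whereas the image of the constant field [Z_1] vanishes
   nowhere. *)
have fx0 : f1 x != 0.
  have [m /(_ x Ux)] := pushZ (fun a => (a == inord 0)%:R).
  rewrite /Zfield (bigD1 (inord 0)) //= eqxx scale1r big1 ?addr0; last first.
    by move=> i /negPf ->; rewrite scale0r.
  rewrite uncoupled_Y1; have [->|//] := eqVneq (f1 x) 0.
  rewrite mul0mx => /esym/f1_inj/vec4_eq0[e _ _ _].
  by move/eqP: e; rewrite oner_eq0.
have [m fm] := pushZ (isotropy_coef x).
have lin (a c : R) : 'd f1 x (vec4 a 0 c 0) *m X_mx m =
    'd f1 x (vec4 ((q1 x - q2 x) * a - (p1 x - p2 x) * c) 0
                  ((q1 x - q2 x) * c + (p1 x - p2 x) * a) 0).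
  apply: (linearization_conj oU Ux f1C fm (Zfield_isotropy x)).
  exact: is_derive_isotropy.
have MM : X_mx m *m X_mx m = 0.
  by apply: (X_mx_sqr_nilpotent fx0); rewrite fm // Zfield_isotropy linear0.
(* Applying [X_mx m] twice to the image of the unit increment of [z_1] gives the image of
   [(z_1 - z_2)^2], which injectivity forces to be zero. *)
have := lin (q1 x - q2 x) (p1 x - p2 x).
have := lin 1 0; rewrite !mulr1 !mulr0 subr0 add0r => <-.
rewrite -mulmxA MM mulmx0 => /esym/f1_inj/vec4_eq0[e1 _ e2 _].
move: q12 e1 e2; rewrite -subr_eq0; set d := q1 x - q2 x; set e := p1 x - p2 x.
(* Here [e1] and [e2] are the real and imaginary parts of [(d + i e)^2 = 0]. *)
move=> d0 e1 e2; have : d ^+ 4 = 0.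
  transitivity (d ^+ 2 * (d * d - e * e) + (2^-1 * (d * e + e * d)) ^+ 2).
    by field.
  by rewrite e1 e2 !mulr0 expr0n addr0.
by move/eqP; rewrite expf_eq0 (negPf d0).
Qed.

End Intrinsic.

Theorem proposition5p1 (R : realType) (b : 'I_6 -> R -> R)
    (b_smooth : forall a : 'I_6, smooth_on (@setT R) (b a)) :
  (is_lie_hamilton_system (X_system b) /\ VG_iso_so13 (X_system b)) /\
  intrinsic (X_system b).
Proof.
split; first by split; [exact: X_system_lie_hamilton|exact: X_system_so13].
split=> T HT; first exact: X_system_not_reducible.
exact: X_system_not_uncoupled.
Qed.
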